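(* Let $m, d \in \mathbb{Z}$ with $m \geq 1$ and $0 \leq d \leq m$. For any OoO SWAG algorithm, there exists a sequence of $3m$ OoO SWAG operations, each with out-of-order distance at most $d$, for which the algorithm requires a total of at least $\Omega(m \log (1+d))$ time.
   Context: A monoid is a triple $(S,\otimes,\mathbf{1})$ where $\otimes : S\times S\to S$ is associative (not necessarily commutative or invertible) with identity $\mathbf{1}$. Timestamps come from a totally ordered set. The out-of-order sliding-window aggregation (OoO SWAG) abstract data type, for a given monoid, maintains a time-ordered window $\langle t_1,v_1\rangle,\dots,\langle t_n,v_n\rangle$ with $t_1<t_2<\dots<t_n$ and $v_i\in S$, supporting: insert$(t,v)$: if $t=t_i$ for some $i$, replace $v_i$ by $v_i\otimes v$; otherwise insert $\langle t,v\rangle$ at the position keeping the window time-ordered. evict$(t)$: if $t=t_i$ for some $i$, remove $\langle t_i,v_i\rangle$; otherwise do nothing. query$()$: return $v_1\otimes\cdots\otimes v_n$, or $\mathbf{1}$ if the window is empty. The out-of-order distance of an insert or evict with timestamp $t$ is the number of entries of the window lying between $t$ and the closer end of the window (for instance, for an insert, when the nearer end is the newest end, it is the number of entries in the window whose timestamp exceeds $t$); in-order insertions at the end and evictions at the front have distance $0$. The algorithm may be instantiated with any monoid; time is measured in the standard (comparison-based) model in which sorting lower bounds apply.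
   Formalization: The totally ordered set of timestamps is assumed infinite; over a finite timestamp set of size K, operations can be done in O(1 + log K) time each, so the Ω(m log(1+d)) bound fails for large m and d. *)

(* Defs.v *)
From HB Require Import structures.
From mathcomp Require Import all_boot all_order all_algebra.
From mathcomp Require Import classical_sets cardinality reals exp.

Set Implicit Arguments.
Unset Strict Implicit.
Unset Printing Implicit Defensive.

Import Order.TTheory GRing.Theory Num.Theory.

(** * The abstract data type *)

Inductive op (T S : Type) : Type :=
| Insert (t : T) (v : S)
| Evict (t : T)
| Query.

Arguments Evict {T S} t.
Arguments Query {T S}.

(* A window lists its entries <t, v> by increasing timestamp; the operations
   below preserve this invariant, and every run starts from [::]. *)
Definition window (T S : Type) := seq (T * S).

Fixpoint window_insert (disp : Order.disp_t) (T : orderType disp) (S : Type)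
    (one : S) (mul : Monoid.law one) (t : T) (v : S) (w : window T S) :
    window T S :=
  match w with
  | [::] => [:: (t, v)]
  | (t1, v1) :: w1 =>
      if t == t1 then (t1, mul v1 v) :: w1
      else if (t < t1)%O then (t, v) :: w
      else (t1, v1) :: window_insert mul t v w1
  end.

Definition window_evict (disp : Order.disp_t) (T : orderType disp) (S : Type)
    (t : T) (w : window T S) : window T S :=
  [seq e <- w | e.1 != t].

Definition window_query (T S : Type) (one : S) (mul : Monoid.law one)
    (w : window T S) : S :=
  \big[mul/one]_(e <- w) e.2.

Definition window_step (disp : Order.disp_t) (T : orderType disp) (S : Type)
    (one : S) (mul : Monoid.law one) (w : window T S) (o : op T S) :
    window T S :=
  match o with
  | Insert t v => window_insert mul t v w
  | Evict t => window_evict t w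
  | Query => w
  end.

(* The answers to the successive queries of [ops], starting from [w]. *)
Fixpoint window_answers (disp : Order.disp_t) (T : orderType disp) (S : Type)
    (one : S) (mul : Monoid.law one) (w : window T S) (ops : seq (op T S)) :
    seq S :=
  match ops with
  | [::] => [::]
  | o :: ops1 =>
      let rest := window_answers mul (window_step mul w o) ops1 in
      if o is Query then window_query mul w :: rest else rest
  end.

(** * Out-of-order distance *)

(* The distance of an operation is relative to the window on which it acts.
   Queries carry no timestamp and are unconstrained. *)
Definition ooo_distance (disp : Order.disp_t) (T : orderType disp) (S : Type)
    (w : window T S) (o : op T S) : nat :=
  match o with
  | Insert t _ | Evict t =>
      minn (count (fun e => (e.1 < t)%O) w) (count (fun e => (t < e.1)%O) w)
  | Query => 0
  end.

Fixpoint ooo_distance_at_most (disp : Order.disp_t) (T : orderType disp)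
    (S : Type) (one : S) (mul : Monoid.law one) (d : nat) (w : window T S)
    (ops : seq (op T S)) : bool :=
  match ops with
  | [::] => true
  | o :: ops1 =>
      (ooo_distance w o <= d) &&
      ooo_distance_at_most mul d (window_step mul w o) ops1
  end.

(** * Comparison-based, monoid-generic algorithms *)

(* A terminating computation that holds timestamps and monoid elements only
   through references (natural numbers), so that its control flow depends on
   timestamps only through three-way comparisons, and on monoid elements not
   at all.  [Mul i j k] stores the product of the elements referenced by [i]
   and [j] and passes a reference to it to [k].  [Tick] stands for any other
   elementary step (pointer manipulation, arithmetic, ...). *)
Inductive prog (A : Type) : Type :=
| Ret (a : A)
| Tick (p : prog A)
| Cmp (i j : nat) (k : comparison -> prog A)
| Mul (i j : nat) (k : nat -> prog A).

(* [state] is arbitrary and its transitions are not charged beyond the steps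
   of the programs, which only enlarges the class of algorithms.  The handlers
   of insert and evict receive references to their arguments; the handler of
   query returns a reference to the answer. *)
Record algorithm : Type := Algorithm {
  state : Type;
  init : state;
  on_insert : state -> nat -> nat -> prog state;
  on_evict : state -> nat -> prog state;
  on_query : state -> prog (state * nat)
}.

Definition compare_timestamps (disp : Order.disp_t) (T : orderType disp)
    (x y : T) : comparison :=
  if (x < y)%O then Lt else if (y < x)%O then Gt else Eq.

(* Reference [i] denotes the [i]-th timestamp received so far.  A dangling
   reference compares as [Eq]. *)
Definition compare_refs (disp : Order.disp_t) (T : orderType disp)
    (ts : seq T) (i j : nat) : comparison :=
  match onth ts i, onth ts j with
  | Some x, Some y => compare_timestamps x y
  | _, _ => Eq
  end.

(* Execution with timestamp store [ts] and element store [vs]: returned value,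
   final element store, and number of elementary steps. *)
Fixpoint run (disp : Order.disp_t) (T : orderType disp) (S : Type)
    (one : S) (mul : Monoid.law one) (A : Type) (ts : seq T) (vs : seq S)
    (p : prog A) : A * seq S * nat :=
  match p with
  | Ret a => (a, vs, 0)
  | Tick p1 =>
      let: (a, vs1, n) := run mul ts vs p1 in (a, vs1, n.+1)
  | Cmp i j k =>
      let: (a, vs1, n) := run mul ts vs (k (compare_refs ts i j)) in
      (a, vs1, n.+1)
  | Mul i j k =>
      let v := mul (nth one vs i) (nth one vs j) in
      let: (a, vs1, n) := run mul ts (rcons vs v) (k (size vs)) in
      (a, vs1, n.+1)
  end.

(* The answers to the queries of [ops], and the total number of steps. *)
Fixpoint exec_from (disp : Order.disp_t) (T : orderType disp) (S : Type)
    (one : S) (mul : Monoid.law one) (A : algorithm) (s : state A)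
    (ts : seq T) (vs : seq S) (ops : seq (op T S)) : seq S * nat :=
  match ops with
  | [::] => ([::], 0)
  | Insert t v :: ops1 =>
      let: (s1, vs1, n) :=
        run mul (rcons ts t) (rcons vs v) (on_insert s (size ts) (size vs)) in
      let: (ans, n1) := exec_from mul s1 (rcons ts t) vs1 ops1 in
      (ans, n + n1)
  | Evict t :: ops1 =>
      let: (s1, vs1, n) := run mul (rcons ts t) vs (on_evict s (size ts)) in
      let: (ans, n1) := exec_from mul s1 (rcons ts t) vs1 ops1 in
      (ans, n + n1)
  | Query :: ops1 =>
      let: ((s1, r), vs1, n) := run mul ts vs (on_query s) in
      let: (ans, n1) := exec_from mul s1 ts vs1 ops1 in
      (nth one vs1 r :: ans, n + n1)
  end.

(* Reference 0 to a monoid element initially denotes the identity. *)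
Definition exec (disp : Order.disp_t) (T : orderType disp) (S : Type)
    (one : S) (mul : Monoid.law one) (A : algorithm) (ops : seq (op T S)) :
    seq S * nat :=
  exec_from mul (init A) [::] [:: one] ops.

Definition answers (disp : Order.disp_t) (T : orderType disp) (S : Type)
    (one : S) (mul : Monoid.law one) (A : algorithm) (ops : seq (op T S)) :
    seq S :=
  (exec mul A ops).1.

Definition total_time (disp : Order.disp_t) (T : orderType disp) (S : Type)
    (one : S) (mul : Monoid.law one) (A : algorithm) (ops : seq (op T S)) :
    nat :=
  (exec mul A ops).2.

(* Correctness over the timestamps [T], whatever the monoid. *)
Definition is_ooo_swag (disp : Order.disp_t) (T : orderType disp)
    (A : algorithm) : Prop :=
  forall (S : Type) (one : S) (mul : Monoid.law one) (ops : seq (op T S)),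
    answers mul A ops = window_answers mul [::] ops.

(* Main.v *)
Require Import Defs.
From HB Require Import structures.
From mathcomp Require Import all_boot all_order all_algebra.
From mathcomp Require Import classical_sets cardinality reals exp.
From mathcomp Require Import perm zify.

Set Implicit Arguments.
Unset Strict Implicit.
Unset Printing Implicit Defensive.

Import Order.TTheory GRing.Theory Num.Theory.
Local Open Scope classical_set_scope.
Local Open Scope ring_scope.

(* Insert q = 2m %/ (d+1) successive blocks of d+1 timestamps, each block in an
   arbitrary order, and spend the remaining operations on queries.  Every insert
   has distance at most d, as only entries of its own block can exceed it.  Over
   the free monoid, with the i-th inserted value being the letter i, the answer
   to a query spells out the order of the timestamps, so the (d+1)!^q inputs get
   distinct answers.  Since control flow depends on the input only through
   three-way comparisons, n steps yield at most 3^n distinct answers, so that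
   (d+1)!^q <= 3^n for some input running n steps.  With b = d+1, b^b <= b!^2
   and m <= q b give b^m <= 9^n. *)

(** * Ternary decision procedures *)

(* [G x] is the output on input [x] together with its cost. *)
Definition ternary_bounded (X : finType) (B : Type) (G : X -> B * nat) : Prop :=
  forall (A : {set X}) (n : nat),
    {in A &, injective (fun x => (G x).1)} ->
    (forall x, x \in A -> ((G x).2 <= n)%N) -> (#|A| <= 3 ^ n)%N.

Lemma ternary_bounded_const (X : finType) (B : Type) (b : B * nat) :
  ternary_bounded (fun _ : X => b).
Proof.
move=> A n Ainj _; apply: (@leq_trans 1); last by rewrite expn_gt0.
apply/card_le1P => x xA y; rewrite !inE; apply/idP/eqP => [yA|-> //].
exact: Ainj.
Qed.

(** If [h] after [G] separates the inputs in [A], so does [G]; hence the bound survives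
    post-processing the output and raising the cost. *)
Lemma ternary_bounded_map (X : finType) (B C : Type) (h : B -> C)
    (G : X -> B * nat) (G' : X -> C * nat) :
  ternary_bounded G ->
  (forall x, (G' x).1 = h (G x).1) -> (forall x, ((G x).2 <= (G' x).2)%N) ->
  ternary_bounded G'.
Proof.
move=> Gb eqG leG A n Ainj An; apply: Gb => [x y xA yA eqxy|x xA].
  by apply: Ainj => //; rewrite !eqG eqxy.
exact: leq_trans (leG x) (An x xA).
Qed.

(** The value of [q] splits [A] into three parts; on each of them a single [H c] computes the
    output, with one step less to spend. *)
Lemma ternary_bounded_branch (X : finType) (B : Type) (q : X -> comparison)
    (H : comparison -> X -> B * nat) :
  (forall c, ternary_bounded (H c)) ->
  ternary_bounded (fun x => ((H (q x) x).1, (H (q x) x).2.+1)).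
Proof.
move=> Hb A n Ainj An.
(* Every cost is a successor, so a budget of 0 forces [A] to be empty. *)
case: n An => [|n] An.
  have -> : A = finset.set0.
    by apply/setP => x; rewrite !inE; apply/negP => /An.
  by rewrite cards0.
pose part c := [set x in A | if q x is Lt then c == 0%N
  else if q x is Gt then c == 1%N else c == 2]%SET.
have bound i c :
    (forall x, x \in part i -> q x = c) -> (#|part i| <= 3 ^ n)%N.
  move=> qc; apply: (Hb c) => [x y xA yA eqxy|x xA].
    have := (qc _ xA, qc _ yA); move: xA yA.
    rewrite !inE => /andP[xA _] /andP[yA _] [qx qy].
    by apply: Ainj => //=; rewrite qx qy.
  have qx := qc _ xA; move: xA; rewrite inE => /andP[/An /=].
  by rewrite qx.
have -> : A = (part 0%N :|: part 1%N :|: part 2)%SET.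
  apply/setP => x; rewrite !inE.
  by case: (x \in A) => //=; case: (q x).
apply: (leq_trans (leq_card_setU _ _)).
have /leq_trans := leq_card_setU (part 0%N) (part 1%N).
move/(_ (3 ^ n + 3 ^ n)%N) => le01.
have {}le01 : (#|part 0 :|: part 1|%SET <= 3 ^ n + 3 ^ n)%N.
  apply: le01; apply: leq_add.
    by apply: (bound _ Lt) => x; rewrite inE => /andP[_]; case: (q x).
  by apply: (bound _ Gt) => x; rewrite inE => /andP[_]; case: (q x).
have le2 : (#|part 2| <= 3 ^ n)%N.
  by apply: (bound _ Eq) => x; rewrite inE => /andP[_]; case: (q x).
by rewrite expnS !mulSn mul0n addn0 addnA leq_add.
Qed.

(** * Executions with input-dependent timestamps *)

(** The input acts on timestamps alone: the kinds of operations and the inserted values are common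
    to all inputs. *)
Definition op_at (X T S : Type) (x : X) (o : op (X -> T) S) : op T S :=
  match o with
  | Insert t v => Insert (t x) v
  | Evict t => Evict (t x)
  | Query => Query
  end.

Section Executions.
Variables (disp : Order.disp_t) (T : orderType disp) (X : finType).
Variables (S : Type) (one : S) (mul : Monoid.law one).

Let at_input (x : X) (ts : seq (X -> T)) : seq T := [seq t x | t <- ts].

(** The continuation [k] stands for the rest of the execution, so that runs compose although their
    results vary with the comparisons. In the induction on [p], only [Cmp] branches on the input. *)
Lemma ternary_bounded_run (B C : Type) (ts : seq (X -> T)) (vs : seq S)
    (p : prog B) (k : B -> seq S -> X -> C * nat) :
  (forall b vs1, ternary_bounded (k b vs1)) ->
  ternary_bounded (fun x =>
    let: (b, vs1, n) := run mul (at_input x ts) vs p in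
    let: (c, n1) := k b vs1 x in (c, (n + n1)%N)).
Proof.
move=> kb; elim: p vs => [b|p IHp|i j f IHf|i j f IHf] vs /=.
- by apply: (ternary_bounded_map (h := id) (kb b vs)) => x; case: (k b vs x).
- apply: (ternary_bounded_map (h := id) (IHp vs)) => x;
    by case: (run _ _ _ _) => [[b vs1] n]; case: (k b vs1 x) => c n1 //=.
- apply: (ternary_bounded_map (h := id) (ternary_bounded_branch
    (q := fun x => compare_refs (at_input x ts) i j) (fun c => IHf c vs))) => x;
    by case: (run _ _ _ _) => [[b vs1] n]; case: (k b vs1 x) => c n1 //=.
- apply: (ternary_bounded_map (h := id) (IHf (size vs)
    (rcons vs (mul (nth one vs i) (nth one vs j))))) => x;
    by case: (run _ _ _ _) => [[b vs1] n]; case: (k b vs1 x) => c n1 //=.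
Qed.

Lemma ternary_bounded_exec_from (A : algorithm) (s : state A)
    (ts : seq (X -> T)) (vs : seq S) (ops : seq (op (X -> T) S)) :
  ternary_bounded (fun x =>
    exec_from mul s (at_input x ts) vs [seq op_at x o | o <- ops]).
Proof.
elim: ops s ts vs => [|[t v|t|] ops IH] s ts vs /=.
- exact: ternary_bounded_const.
- apply: (ternary_bounded_map (h := id) (ternary_bounded_run (ts := rcons ts t)
    (vs := rcons vs v) (p := on_insert s (size ts) (size vs))
    (fun s1 vs1 => IH s1 (rcons ts t) vs1))) => x;
    by rewrite /at_input map_rcons size_map.
- apply: (ternary_bounded_map (h := id) (ternary_bounded_run (ts := rcons ts t)
    (vs := vs) (p := on_evict s (size ts))
    (fun s1 vs1 => IH s1 (rcons ts t) vs1))) => x;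
    by rewrite /at_input map_rcons size_map.
(* Once the state and the store are fixed, prepending the answer of the query is a post-processing
   of the later answers. *)
- have step (sr : state A * nat) vs1 : ternary_bounded (fun x =>
      let: (ans, n1) :=
        exec_from mul sr.1 (at_input x ts) vs1 [seq op_at x o | o <- ops] in
      (nth one vs1 sr.2 :: ans, n1)).
    by apply: (ternary_bounded_map (h := cons (nth one vs1 sr.2))
      (IH sr.1 ts vs1)) => x; case: (exec_from _ _ _ _).
  apply: (ternary_bounded_map (h := id)
    (ternary_bounded_run (ts := ts) (vs := vs) (p := on_query s) step)) => x;
    case: (run _ _ _ _) => [[[s1 r] vs1] n] /=;
    by case: (exec_from _ _ _ _).
Qed.

Lemma ternary_bounded_exec (A : algorithm) (ops : seq (op (X -> T) S)) :
  ternary_bounded (fun x => exec mul A [seq op_at x o | o <- ops]).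
Proof. exact: (ternary_bounded_exec_from (s := init A) (ts := [::])). Qed.

End Executions.

(** * Windows *)

Section Windows.
Variables (disp : Order.disp_t) (T : orderType disp).
Variables (S : eqType) (one : S) (mul : Monoid.law one).
Implicit Types (w : window T S) (t : T) (v : S).

Lemma perm_window_insert t v w :
  t \notin unzip1 w -> perm_eq (window_insert mul t v w) ((t, v) :: w).
Proof.
elim: w => [|[t1 v1] w IHw] //=; rewrite inE negb_or => /andP[/negbTE-> tw].
case: ifP => // _.
rewrite perm_sym (perm_catCA [:: (t, v)] [:: (t1, v1)] w) /= perm_cons perm_sym.
exact: IHw.
Qed.

Lemma sorted_window_insert t v w :
  sorted <%O (unzip1 w) -> sorted <%O (unzip1 (window_insert mul t v w)).
Proof.
elim: w => [|[t1 v1] w IHw] //=; case: ifP => // tt1; case: ifP => [lt_tt1 /=|].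
  by rewrite lt_tt1.
move=> nlt; have lt_t1t : (t1 < t)%O by rewrite lt_neqAle eq_sym tt1 leNgt nlt.
move=> /= t1w; have /IHw := path_sorted t1w.
case: w t1w {IHw} => [|[t2 v2] w] /=; first by rewrite lt_t1t.
(* The tail after insertion starts with [t] or [t2], both above [t1]. *)
by move=> /andP[t12 _]; do 2?[case: ifP => _]; rewrite /= ?t12 ?lt_t1t.
Qed.

Section Inserts.
Variables (d N : nat) (t : nat -> T) (v : nat -> S).
Hypothesis t_inj : {in gtn N &, injective t}.
Hypothesis t_dist : forall i, (i < N)%N ->
  (count (fun j => (t i < t j)%O) (iota 0 i) <= d)%N.

Let inserts a k := [seq Insert (t i) (v i) | i <- iota a k].
Let entries a := [seq (t i, v i) | i <- iota 0 a].

Lemma window_step_inserts a k w :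
  (a + k <= N)%N -> perm_eq w (entries a) -> sorted <%O (unzip1 w) ->
  let w' := foldl (window_step mul) w (inserts a k) in
  [/\ perm_eq w' (entries (a + k)), sorted <%O (unzip1 w') &
      forall ops, ooo_distance_at_most mul d w (inserts a k ++ ops) =
                  ooo_distance_at_most mul d w' ops].
Proof.
rewrite /=; elim: k a w => [|k IHk] a w; first by rewrite addn0.
rewrite addnS => ltN wa ws /=.
have fresh : t a \notin unzip1 w.
  rewrite (perm_mem (perm_map fst wa)) -map_comp.
  apply/mapP => -[j]; rewrite mem_iota /= => ja /t_inj E.
  suff eqaj : a = j by rewrite eqaj ltnn in ja.
  by apply: E; rewrite inE; lia.
have w'a : perm_eq (window_insert mul (t a) (v a) w) (entries a.+1).
  apply: (perm_trans (perm_window_insert _ fresh)).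
  rewrite /entries -[in iota 0 a.+1]addn1 iotaD map_cat.
  by rewrite -cat1s perm_catC perm_cat2r.
have [|-> -> distE] := IHk a.+1 _ _ w'a (sorted_window_insert _ _ ws).
  by rewrite addSn.
split=> // ops; rewrite distE.
(* Of the two counts in the minimum, [t_dist] bounds that of the later entries. *)
apply/andb_idl => _; rewrite geq_min; apply/orP; right.
by rewrite (seq.permP wa) count_map; apply: t_dist; lia.
Qed.

End Inserts.

Lemma ooo_distance_at_most_queries d w k :
  ooo_distance_at_most mul d w (nseq k Query).
Proof. by elim: k. Qed.

Lemma window_answers_inserts_query w (es : seq (T * S)) ops :
  let ins := [seq Insert e.1 e.2 | e <- es] in
  ohead (window_answers mul w (ins ++ Query :: ops)) =
    Some (window_query mul (foldl (window_step mul) w ins)).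
Proof. by elim: es w => /=. Qed.

End Windows.

Lemma window_query_cat (T A : Type) (w : window T (seq A)) :
  window_query (@cat A : Monoid.law [::]) w = flatten (unzip2 w).
Proof.
rewrite /window_query; elim: w => [|e w IHw]; first by rewrite big_nil.
by rewrite big_cons IHw.
Qed.

(** Recovers the individual values of a window from its query over the free monoid. *)
Lemma singletons_flatten_inj (A : Type) (s1 s2 : seq (seq A)) :
  all (fun u => size u == 1%N) s1 -> all (fun u => size u == 1%N) s2 ->
  flatten s1 = flatten s2 -> s1 = s2.
Proof.
elim: s1 s2 => [|[|a [|? ?]] s1 IH] [|[|b [|? ?]] s2] //= s1P s2P [<- eq12].
by rewrite (IH s2).
Qed.

(** * Block permutations *)

Section Blocks.
Variables (d q : nat).
Let b := d.+1.

(** Block number and offset are quotient and remainder by [b]. Block numbers above [q] reuse the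
    permutation of block 0 through [inord], which keeps the map injective on all naturals. *)
Definition block_perm (f : {ffun 'I_q.+1 -> 'S_d.+1}) (i : nat) : nat :=
  ((i %/ b) * b + f (inord (i %/ b)) (inord (i %% b)))%N.

Lemma block_perm_divn f i : (block_perm f i %/ b)%N = (i %/ b)%N.
Proof. by rewrite /block_perm divnMDl // (divn_small (ltn_ord _)) addn0. Qed.

Lemma block_perm_lt f i : (i < q.+1 * b)%N -> (block_perm f i < q.+1 * b)%N.
Proof. by rewrite -!ltn_divLR // block_perm_divn. Qed.

Lemma block_perm_inj f : injective (block_perm f).
Proof.
move=> i j eqij.
have eqdiv : (i %/ b = j %/ b)%N.
  by rewrite -(block_perm_divn f) eqij block_perm_divn.
move: eqij; rewrite /block_perm eqdiv => /addnI/val_inj/perm_inj/(congr1 val).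
rewrite /= !inordK ?ltn_pmod // => eqmod.
by rewrite (divn_eq i b) (divn_eq j b) eqdiv eqmod.
Qed.

Lemma block_perm_fun_inj f g :
  (forall i, (i < q.+1 * b)%N -> block_perm f i = block_perm g i) -> f = g.
Proof.
move=> eqfg; apply/ffunP => k; apply/permP => j; apply: val_inj => /=.
have lt : (k * b + j < q.+1 * b)%N.
  by rewrite -ltn_divLR // divnMDl // (divn_small (ltn_ord j)) addn0.
have := eqfg _ lt; rewrite /block_perm.
rewrite divnMDl // (divn_small (ltn_ord j)) addn0.
by rewrite modnMDl (modn_small (ltn_ord j)) !inord_val => /addnI.
Qed.

(** The block of [j] is not after that of [i], and an offset is less than [b]. *)
Lemma block_perm_lt_add f i j :
  (j <= i)%N -> (block_perm f j < block_perm f i + b)%N.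
Proof.
move=> ji; have le := leq_div2r b ji.
have := ltn_ord (f (inord (j %/ b)) (inord (j %% b))).
have := leq_mul2r b (j %/ b) (i %/ b); rewrite le orbT => {}le.
by rewrite /block_perm -/b; lia.
Qed.

(** By injectivity, the larger earlier values are distinct members of the [d] integers that follow
    [block_perm f i]. *)
Lemma count_block_perm f i :
  (count (fun j => block_perm f i < block_perm f j)%N (iota 0 i) <= d)%N.
Proof.
rewrite -size_filter -(size_map (block_perm f)).
rewrite -[leqRHS](size_iota (block_perm f i).+1).
apply: uniq_leq_size.
  by rewrite map_inj_uniq ?filter_uniq ?iota_uniq //; exact: block_perm_inj.
move=> x /mapP[j]; rewrite mem_filter mem_iota => /andP[lt /andP[_ ji]] ->.
rewrite mem_iota lt /=.
by rewrite addSnnS; exact: block_perm_lt_add (ltnW ji).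
Qed.

End Blocks.

(** * Increasing timestamps and factorial estimates *)

Lemma infinite_increasing (disp : Order.disp_t) (T : orderType disp) (N : nat) :
  infinite_set [set: T] ->
  exists x : nat -> T, {in gtn N &, {mono x : i j / (i < j)%N >-> (i < j)%O}}.
Proof.
(* An infinite order may have no infinite increasing sequence, as with the negative integers, so a
   finite subset is sorted instead. *)
move=> Tinf; have [B _ Bsize] := infinite_set_fset N Tinf.
have [x0 _] := infinite_setN0 Tinf.
exists (nth x0 (sort <=%O (finmap.enum_fset B))) => i j; rewrite !inE => iN jN.
apply: lt_sorted_ltn_nth; rewrite ?inE ?size_sort.
- by rewrite sort_lt_sorted finmap.fset_uniq.
- exact: leq_trans iN Bsize.
- exact: leq_trans jN Bsize.
Qed.

(** Pair the factor [i] of one factorial with [n.+1 - i] of the other: each product is at least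
    [n]. *)
Lemma expn_self_le_fact_sqr (n : nat) : (n ^ n <= n`! ^ 2)%N.
Proof.
have -> : (n ^ n = \prod_(1 <= i < n.+1) n)%N.
  by rewrite prod_nat_const_nat subn1.
rewrite -mulnn [X in (_ <= _ * X)%N]fact_prod.
rewrite [X in (_ <= _ * X)%N]big_nat_rev fact_prod -big_split /=.
rewrite big_nat_cond [leqRHS]big_nat_cond; apply: leq_prod => i.
rewrite andbT add1n subSS => /andP[i1 iN].
have -> : (n.+1 - i = (n - i).+1)%N by lia.
have : (n = i + (n - i))%N by lia.
(* With [n = i + j], the excess of [i * j.+1] over [n] is [(i - 1) * j]. *)
by move: (n - i)%N => j ->; nia.
Qed.

Lemma expn_le_of_fact_expn_le (m d q n : nat) :
  (m <= q * d.+1)%N -> (d.+1`! ^ q <= 3 ^ n)%N -> (d.+1 ^ m <= 9 ^ n)%N.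
Proof.
move=> mq le3; apply: (@leq_trans (d.+1 ^ (q * d.+1))); first exact: leq_pexp2l.
rewrite mulnC expnM; apply: (@leq_trans ((d.+1`! ^ 2) ^ q)).
  case: (q) => // r; rewrite leq_exp2r //; exact: expn_self_le_fact_sqr.
by rewrite -[9%N]/(3 ^ 2)%N expnAC [leqRHS]expnAC leq_exp2r.
Qed.

(** * The lower bound *)

Section LowerBound.
Variables (disp : Order.disp_t) (T : orderType disp) (d q k : nat).
Variable x : nat -> T.
Let N := (q.+1 * d.+1)%N.
Hypothesis x_mono : {in gtn N &, {mono x : i j / (i < j)%N >-> (i < j)%O}}.

Let X := {ffun 'I_q.+1 -> 'S_d.+1}.
Let mul : Monoid.law [::] := @cat nat.

(** The letter inserted is the insertion index, whatever [f]. Using [k.+1] guarantees a query. *)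
Definition block_ops : seq (op (X -> T) (seq nat)) :=
  [seq Insert (fun f : X => x (block_perm f i)) [:: i] | i <- iota 0 N]
    ++ nseq k.+1 Query.

Definition block_ops_at (f : X) : seq (op T (seq nat)) :=
  [seq op_at f o | o <- block_ops].

Let block_inserts_at (f : X) : seq (op T (seq nat)) :=
  [seq Insert (x (block_perm f i)) [:: i] | i <- iota 0 N].

Lemma block_ops_atE f :
  block_ops_at f = block_inserts_at f ++ nseq k.+1 Query.
Proof.
by rewrite /block_ops_at map_cat -map_comp map_nseq.
Qed.

Lemma size_block_ops_at f : size (block_ops_at f) = (N + k.+1)%N.
Proof. by rewrite block_ops_atE size_cat size_map size_iota size_nseq. Qed.

Let x_inj : {in gtn N &, injective x}.
Proof.
move=> i j iN jN eqx.
have := x_mono iN jN; have := x_mono jN iN; rewrite eqx ltxx.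
by lia.
Qed.

Lemma block_window f :
  let w := foldl (window_step mul) [::] (block_inserts_at f) in
  [/\ perm_eq w [seq (x (block_perm f i), [:: i]) | i <- iota 0 N],
      sorted <%O (unzip1 w) &
      forall ops, ooo_distance_at_most mul d [::] (block_inserts_at f ++ ops) =
                  ooo_distance_at_most mul d w ops].
Proof.
have bN i : (i < N)%N -> block_perm f i \in gtn N by exact: block_perm_lt.
apply: (@window_step_inserts _ _ _ _ _ d N (fun i => x (block_perm f i))
  (fun i => [:: i]) _ _ 0) => //.
  move=> i j iN jN /x_inj E; apply: (@block_perm_inj d q f).
  by apply: E; exact: bN.
move=> i iN.
rewrite (eq_in_count (a2 := fun j => block_perm f i < block_perm f j)%N).
  exact: count_block_perm.
move=> j; rewrite mem_iota => /andP[_ ji].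
by apply: x_mono; apply: bN => //; apply: ltn_trans iN.
Qed.

Lemma block_ops_distance f : ooo_distance_at_most mul d [::] (block_ops_at f).
Proof.
have [_ _ distE] := block_window f.
by rewrite block_ops_atE distE ooo_distance_at_most_queries.
Qed.

(** All inputs fill the same set of timestamps, so their final windows can differ only in the
    arrangement of the letters. *)
Lemma block_window_timestamps f :
  unzip1 (foldl (window_step mul) [::] (block_inserts_at f)) = mkseq x N.
Proof.
have [wp ws _] := block_window f.
apply: lt_sorted_eq ws _ _ => [|t].
  rewrite /mkseq sorted_map.
  apply: (sub_in_sorted (P := gtn N) (e := ltn)) => [i j iN jN /=||].
  - by rewrite x_mono.
  - by apply/allP => i; rewrite mem_iota.
  - exact: iota_ltn_sorted.
rewrite (perm_mem (perm_map fst wp)) -map_comp.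
have -> : [seq (fst \o (fun i => (x (block_perm f i), [:: i]))) i |
    i <- iota 0 N]
  = [seq x i | i <- [seq block_perm f i | i <- iota 0 N]] by rewrite -map_comp.
apply: eq_mem_map => i.
have bN j : j \in iota 0 N -> block_perm f j \in iota 0 N.
  by rewrite !mem_iota; exact: block_perm_lt.
(* An injection of a finite set into itself is onto. *)
apply: (uniq_min_size _ _ _).2; rewrite ?size_map //.
  by rewrite map_inj_uniq ?iota_uniq //; exact: block_perm_inj.
by move=> _ /mapP[j jN ->]; exact: bN.
Qed.

Lemma block_answers_inj :
  injective (fun f => window_answers mul [::] (block_ops_at f)).
Proof.
move=> f g /(congr1 ohead); rewrite !block_ops_atE.
have insE h : block_inserts_at h = [seq Insert e.1 e.2 |
    e <- [seq (x (block_perm h i), [:: i]) | i <- iota 0 N]].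
  by rewrite -map_comp.
rewrite !insE !window_answers_inserts_query -!insE => /Some_inj.
have [fp _ _] := block_window f; have [gp _ _] := block_window g.
have := block_window_timestamps f; rewrite -(block_window_timestamps g).
move: (foldl _ _ (block_inserts_at f)) (foldl _ _ (block_inserts_at g)) fp gp.
move=> wf wg fp gp eq1.
rewrite !window_query_cat => /singletons_flatten_inj eq2.
have singl (h : X) w :
    perm_eq w [seq (x (block_perm h i), [:: i]) | i <- iota 0 N] ->
    all (fun u => size u == 1%N) (unzip2 w).
  move=> wp; rewrite (perm_all _ (perm_map snd wp)) -map_comp.
  by apply/allP => _ /mapP[i _ ->].
have {}eq2 := eq2 (singl f _ fp) (singl g _ gp).
have eqw : wf = wg by rewrite -[wf]zip_unzip -[wg]zip_unzip eq1 eq2.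
(* In the common window, the entry with letter [i] carries the timestamp prescribed by [f] and by
   [g]. *)
apply: (@block_perm_fun_inj d q) => i iN.
have : (x (block_perm f i), [:: i]) \in wf.
  by rewrite (perm_mem fp); apply: map_f; rewrite mem_iota.
rewrite eqw (perm_mem gp) => /mapP[j _ [eqx eqij]]; rewrite -eqij in eqx.
by apply: x_inj eqx; exact: block_perm_lt.
Qed.

Lemma exists_slow_block_ops (A : algorithm) : is_ooo_swag T A ->
  exists f, (d.+1`! ^ q.+1 <= 3 ^ total_time mul A (block_ops_at f))%N.
Proof.
move=> Acorrect; have X_gt0 : (0 < #|{: X}|)%N.
  by rewrite card_ffun card_Sn expn_gt0 fact_gt0.
(* The slowest input is taken, so that its time bounds the cost on all inputs at once. *)
have [f maxf] :=
  bigop.eq_bigmax (fun f => total_time mul A (block_ops_at f)) X_gt0.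
exists f; rewrite -maxf -card_Sn -[in (_ ^ q.+1)%N](card_ord q.+1).
rewrite -card_ffun -cardsT.
apply: (ternary_bounded_exec (mul := mul) (A := A) (ops := block_ops)).
  by move=> g h _ _ eqgh; apply: block_answers_inj; rewrite -!Acorrect.
move=> g _; exact: (leq_bigmax g).
Qed.

End LowerBound.

Theorem theorem2p2 (R : realType) :
  exists2 c : R, 0 < c &
  forall (disp : Order.disp_t) (T : orderType disp) (m d : nat)
      (A : algorithm),
    infinite_set [set: T] ->
    (1 <= m)%N -> (d <= m)%N ->
    is_ooo_swag T A ->
    exists (S : Type) (one : S) (mul : Monoid.law one) (ops : seq (op T S)),
      [/\ size ops = (3 * m)%N,
          ooo_distance_at_most mul d [::] ops &
          c * (m%:R * ln (1 + d%:R)) <= (total_time mul A ops)%:R].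
Proof.
have ln9_gt0 : 0 < ln (9 : R) by apply: ln_gt0; rewrite ltr1n.
(* Logarithms of [d.+1 ^ m <= 9 ^ n] give this constant. *)
exists (ln 9)^-1; first by rewrite invr_gt0.
move=> disp T m d A Tinf m_gt0 le_dm Acorrect.
have := divn_eq (2 * m) d.+1; have := ltn_pmod (2 * m) (ltn0Sn d).
(* A zero quotient would mean [2 * m <= d <= m], against [1 <= m]. *)
case: ((2 * m) %/ d.+1)%N => [|q] ltr eq2m; first by lia.
set N := (q.+1 * d.+1)%N in eq2m.
have [x x_mono] := infinite_increasing N Tinf.
(* Since [N <= 2 * m], at least [m] queries remain; the predecessor offsets the [k.+1] in
   [block_ops]. *)
have [f fslow] := exists_slow_block_ops (3 * m - N).-1 x_mono Acorrect.
exists (seq nat), [::], (@cat nat : Monoid.law [::]).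
exists (block_ops_at (3 * m - N).-1 x f); split.
- by rewrite size_block_ops_at -/N; lia.
- exact: block_ops_distance.
(* The remainder of [2 * m] is at most [d], hence at most [m]. *)
have le_mN : (m <= N)%N by lia.
have := expn_le_of_fact_expn_le le_mN fslow.
set n := total_time _ _ _; rewrite -(ler_nat R) !natrX => le9.
rewrite mulrC ler_pdivrMr // nat1r !mulr_natl -!lnXn ?ltr0n //.
by rewrite ler_ln ?posrE ?exprn_gt0 ?ltr0n.
Qed.
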